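(* Let $(\mathfrak{A}, \mathbb{Z}, \Theta)$ be a C*-dynamical system with $\mathfrak{A}$ a nonzero separable unital C*-algebra. If $a \in \mathfrak{A}$ is a positive element, then $\Gamma(a) = m(a \vert \mathcal{S}^{\mathbb{Z}})$.
   Context: A C*-dynamical system $(\mathfrak{A}, \mathbb{Z}, \Theta)$ consists of a unital C*-algebra $\mathfrak{A}$ and a group homomorphism $\Theta : \mathbb{Z} \to \operatorname{Aut}(\mathfrak{A})$, $j \mapsto \Theta_j$, into the *-automorphisms of $\mathfrak{A}$. $\mathcal{S}^{\mathbb{Z}}$ denotes the set of $\Theta$-invariant states on $\mathfrak{A}$ (states $\phi$ with $\phi \circ \Theta_j = \phi$ for all $j \in \mathbb{Z}$), which is nonempty. For self-adjoint $x \in \mathfrak{A}$ and weak*-compact convex $K \subseteq \mathcal{S}^{\mathbb{Z}}$, $m(x \vert K) := \sup_{\psi \in K} \psi(x)$. The gauge of a positive element $a \in \mathfrak{A}$ is $\Gamma(a) := \lim_{k \to \infty} \frac{1}{k} \left\| \sum_{j=0}^{k-1} \Theta_j a \right\|$; the limit exists by subadditivity. *)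

(* Defs.v *)
(* The complex field is [R[i]], for an arbitrary [R : realType]. Its order is   *)
(* partial: [0 <= z] says that [z] is real and nonnegative. Norms of vectors   *)
(* are elements of [R[i]].                                                     *)
From HB Require Import structures.
From mathcomp Require Import all_boot all_order all_algebra.
From mathcomp Require Import complex.
From mathcomp Require Import all_classical all_reals all_analysis.
Set Implicit Arguments.
Unset Strict Implicit.
Unset Printing Implicit Defensive.
Import Order.TTheory GRing.Theory Num.Theory.
Import numFieldNormedType.Exports.
Local Open Scope classical_set_scope.
Local Open Scope complex_scope.
Local Open Scope ring_scope.

(* Num.NumDomain already joins rings and normed Z-modules, over itself, and    *)
(* Hierarchy Builder allows no second join: the ring operations are therefore  *)
(* fields here, and the [algType] structure is derived from them below.        *)
HB.mixin Record isCStarAlgebra (R : realType) A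
    of CompleteNormedModule R[i] A := {
  cstar_one : A;
  cstar_mul : A -> A -> A;
  cstar_mulA : associative cstar_mul;
  cstar_mul1l : left_id cstar_one cstar_mul;
  cstar_mul1r : right_id cstar_one cstar_mul;
  cstar_mulDl : left_distributive cstar_mul +%R;
  cstar_mulDr : right_distributive cstar_mul +%R;
  cstar_one_neq0 : cstar_one != 0;
  cstar_scalerAl : forall (c : R[i]) (x y : A),
    c *: cstar_mul x y = cstar_mul (c *: x) y;
  cstar_scalerAr : forall (c : R[i]) (x y : A),
    c *: cstar_mul x y = cstar_mul x (c *: y);
  star : A -> A;
  starD : {morph star : x y / x + y};
  starZ : forall (c : R[i]) (x : A), star (c *: x) = conjc c *: star x;
  starM : forall x y : A, star (cstar_mul x y) = cstar_mul (star y) (star x);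
  starK : involutive star;
  cstar_normM : forall x y : A, `|cstar_mul x y| <= `|x| * `|y|;
  cstar_identity : forall x : A, `|cstar_mul (star x) x| = `|x| ^+ 2
}.

(* Unital and nonzero, by [cstar_one_neq0]. *)
#[short(type="cstarAlgType")]
HB.structure Definition CStarAlgebra (R : realType) :=
  {A of isCStarAlgebra R A & CompleteNormedModule R[i] A}.

HB.instance Definition _ (R : realType) (A : cstarAlgType R) :=
  GRing.Zmodule_isNzRing.Build (CStarAlgebra.sort A)
    (@cstar_mulA R A) (@cstar_mul1l R A) (@cstar_mul1r R A)
    (@cstar_mulDl R A) (@cstar_mulDr R A) (@cstar_one_neq0 R A).

HB.instance Definition _ (R : realType) (A : cstarAlgType R) :=
  GRing.Lmodule_isLalgebra.Build R[i] (CStarAlgebra.sort A)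
    (@cstar_scalerAl R A).

HB.instance Definition _ (R : realType) (A : cstarAlgType R) :=
  GRing.Lalgebra_isAlgebra.Build R[i] (CStarAlgebra.sort A)
    (@cstar_scalerAr R A).

Definition separable (T : topologicalType) : Prop :=
  exists2 D : set T, countable D & dense D.

Section CStarAlgebras.
Variables (R : realType) (A : cstarAlgType R).
Implicit Types (x a : A) (f : A -> A) (phi : A -> R[i]) (Theta : int -> A -> A).

Definition invertible x : Prop := exists y : A, x * y = 1 /\ y * x = 1.

Definition spectrum x : set R[i] := [set z | ~ invertible (z%:A - x)].

Definition selfadjoint x : Prop := star x = x.

Definition positive a : Prop :=
  selfadjoint a /\ forall z, spectrum a z -> 0 <= z.

(* Preservation of the unit is automatic for bijective [f]. *)
Definition star_automorphism f : Prop :=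
  [/\ linear f, {morph f : x y / x * y}, {morph f : x / star x} & bijective f].

Definition cstar_dynamical_system Theta : Prop :=
  (forall j, star_automorphism (Theta j)) /\
  (forall i j, Theta (i + j) = Theta i \o Theta j).

Definition state phi : Prop :=
  [/\ scalar phi, forall a, positive a -> 0 <= phi a & phi 1 = 1].

Definition invariant_states Theta : set (A -> R[i]) :=
  [set phi | state phi /\ forall j, phi \o Theta j = phi].

(* m(x|K); states are real-valued on self-adjoint elements, so the real part *)
(* only changes the type of the values.                                      *)
Definition max_value x (K : set (A -> R[i])) : R :=
  sup [set complex.Re (psi x) | psi in K].

Definition gauge Theta a : R :=
  lim ((fun k : nat =>
    k%:R^-1 * complex.Re `| \sum_(j < k) Theta (Posz j) a |) @ \oo).

End CStarAlgebras.

(* Main.v *)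
(* For self-adjoint [h], invertibility of [h - ib] follows by moving [ib] far   *)
(* away (Arens), and if [|h| = 1] then [1 - h^2] is not invertible, since       *)
(* [|(1 - h^2) h^(2^k - 1)|] tends to [0] while [|h^(2^k)| = 1]. Hence the norm *)
(* of [h] is its spectral radius, and positivity of [x] becomes the inequality  *)
(* [|t - x| <= t] for [t >= |x|], which is visibly stable under sums.           *)
(*                                                                              *)
(* For self-adjoint [x] let [p x] be the infimum of the [c] such that           *)
(* [S_k x <= c k] for all large [k], where [S_k x] is the [k]-th ergodic sum.   *)
(* This is sublinear, nonpositive at [Theta_1 x - x], [x - Theta_1 x] and at    *)
(* negative elements. By Hahn-Banach it dominates a linear functional with the  *)
(* same value at [a], which is an invariant state [phi]. On the other hand      *)
(* [psi a <= |S_k a| / k] for every invariant state [psi] and [k > 0], whereas  *)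
(* [|S_k a| / k <= c] for large [k] as soon as [c > p a = phi a].               *)
Require Import Defs.
From mathcomp Require Import all_boot all_order all_algebra.
From mathcomp Require Import complex.
From mathcomp Require Import ring lra.
From mathcomp Require Import all_classical all_reals all_analysis.

Set Implicit Arguments.
Unset Strict Implicit.
Unset Printing Implicit Defensive.
Import Order.TTheory GRing.Theory Num.Theory.
Import numFieldNormedType.Exports.
Local Open Scope classical_set_scope.
Local Open Scope complex_scope.
Local Open Scope ring_scope.

(** * Norm and invertibility *)

(** The averages [|S_k a| / k] are squeezed against the supremum [m] of the values of invariant
    states at [a]. From below: [S_k a] is at most its norm in the order of the algebra, and an
    invariant state maps it to [k] times its value at [a], so [m] bounds every average with [k > 0]
    from below ([invariant_state_le]). From above: [exists_invariant_state] applies [hahn_banach] to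
    [ergodic_upper], so that [ergodic_upper] at [a] is the value of an invariant state and hence at
    most [m]. Some [c] as close to [m] as desired then satisfies [S_k a <= c k] for large [k], and
    positivity of [S_k a] turns this into a norm bound ([ergodic_norm_le]). Existence and value of
    the limit come out together in [ergodic_norm_cvg].

    The passages between order and norm rest on [positive_of_norm] and [norm_of_positive]. The
    former uses that self-adjoint elements have real spectrum ([spectrum_selfadjoint]), the latter
    that their norm is the spectral radius ([rnorm_le_spectrum]). *)

Section Norm.
Variables (R : realType) (A : cstarAlgType R).
Implicit Types (x y z h : A).

(** Norms lie in [R[i]], whose order is partial; estimates are made on this real copy. *)
Definition rnorm x : R := complex.Re `|x|.

Lemma rnormE x : `|x| = (rnorm x)%:C.
Proof. by rewrite /rnorm RRe_real. Qed.

Lemma rnorm_ge0 x : 0 <= rnorm x.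
Proof. by have := normr_ge0 x; rewrite rnormE ler0c. Qed.

Lemma rnormD x y : rnorm (x + y) <= rnorm x + rnorm y.
Proof. by rewrite -lecR rmorphD /= -!rnormE ler_normD. Qed.

Lemma rnormN x : rnorm (- x) = rnorm x.
Proof. by rewrite /rnorm normrN. Qed.

Lemma rnorm0 : rnorm 0 = 0.
Proof. by rewrite /rnorm normr0. Qed.

Lemma rnormM x y : rnorm (x * y) <= rnorm x * rnorm y.
Proof. by rewrite -lecR rmorphM /= -!rnormE; exact: cstar_normM. Qed.

Lemma rnorm_star_mul x : rnorm (star x * x) = rnorm x ^+ 2.
Proof.
by apply: complexI; rewrite rmorphXn /= -!rnormE; exact: cstar_identity.
Qed.

Lemma rnormZ (c : R[i]) x : rnorm (c *: x) = complex.Re `|c| * rnorm x.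
Proof.
by apply: complexI; rewrite rmorphM /= /rnorm !RRe_real // normrZ.
Qed.

Lemma rnormZr (r : R) x : rnorm (r%:C *: x) = `|r| * rnorm x.
Proof. by rewrite rnormZ normc_def /= expr0n addr0 sqrtr_sqr. Qed.

Lemma rnorm_eq0 x : rnorm x = 0 -> x = 0.
Proof. by move=> x0; apply/normr0_eq0; rewrite rnormE x0. Qed.

(** Cancel one factor in [|y|^2 = |star y * y| <= |star y| |y|], then exchange [y] and [star y]. *)
Lemma rnorm_star x : rnorm (star x) = rnorm x.
Proof.
suff le y : rnorm y <= rnorm (star y).
  by apply/le_anti; rewrite le andbT -{2}(starK x) le.
have [y0|] := eqVneq (rnorm y) 0; first by rewrite y0 rnorm_ge0.
rewrite neq_lt ltNge rnorm_ge0 /= => y0.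
by rewrite -(ler_pM2r y0) -expr2 -rnorm_star_mul rnormM.
Qed.

Lemma star_mul x y : star (x * y) = star y * star x.
Proof. exact: starM. Qed.

Lemma star1 : star (1 : A) = 1.
Proof. by rewrite -[LHS]mulr1 -{2}(starK 1) -star_mul mulr1 starK. Qed.

Lemma star0 : star (0 : A) = 0.
Proof. by rewrite -(scale0r 0) starZ rmorph0 !scale0r. Qed.

Lemma starN x : star (- x) = - star x.
Proof. by apply/eqP; rewrite -addr_eq0 -starD addNr star0. Qed.

Lemma rnorm1 : rnorm 1 = 1.
Proof.
have := rnorm_star_mul 1; rewrite star1 mulr1 => /eqP.
rewrite expr2 -subr_eq0 -{1}(mul1r (rnorm 1)) -mulrBl mulf_eq0 subr_eq0.
case/orP => [/eqP//|/eqP/rnorm_eq0/eqP]; by rewrite oner_eq0.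
Qed.

End Norm.

(** * Neumann series and the resolvent outside the norm disc *)

Section Invertible.
Variables (R : realType) (A : cstarAlgType R).
Implicit Types (x y z h : A) (c : R[i]) (r s t : R).

Lemma invertibleM x y : invertible x -> invertible y -> invertible (x * y).
Proof.
move=> [x' [xx' x'x]] [y' [yy' y'y]]; exists (y' * x'); split.
  by rewrite mulrA -(mulrA x) yy' mulr1.
by rewrite mulrA -(mulrA y') x'x mulr1.
Qed.

Lemma invertibleZ c x : c != 0 -> invertible x -> invertible (c *: x).
Proof.
move=> c0 [y [xy yx]]; exists (c^-1 *: y).
by rewrite -!scalerAl -!scalerAr !scalerA xy yx mulfV ?mulVf ?scale1r.
Qed.

Lemma invertibleN x : invertible x -> invertible (- x).
Proof.
by rewrite -scaleN1r; apply: invertibleZ; rewrite oppr_eq0 oner_eq0.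
Qed.

Lemma rnormX_le x n : rnorm (x ^+ n) <= rnorm x ^+ n.
Proof.
elim: n => [|n IH]; first by rewrite !expr0 rnorm1.
by rewrite !exprS (le_trans (rnormM _ _))// ler_wpM2l ?rnorm_ge0.
Qed.

Lemma rnorm_sum I (s : seq I) (F : I -> A) :
  rnorm (\sum_(i <- s) F i) <= \sum_(i <- s) rnorm (F i).
Proof.
elim/big_ind2 : _ => [|? ? ? ? ? ?|//]; first by rewrite rnorm0.
by rewrite (le_trans (rnormD _ _))// lerD.
Qed.

Lemma rnorm_eq0_small x : (forall e : R, 0 < e -> rnorm x <= e) -> x = 0.
Proof.
move=> h; apply/rnorm_eq0/le_anti; rewrite rnorm_ge0 andbT.
by apply/ler_addgt0Pr => e e0; rewrite add0r h.
Qed.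

Lemma cvg_rnorm (u : nat -> A) (l : A) :
  u @ \oo --> l -> forall e : R, 0 < e -> \forall n \near \oo, rnorm (l - u n) < e.
Proof.
move=> ul e e0; have /cvgrPdist_lt/(_ e%:C) := ul.
rewrite ltcR => /(_ e0); apply: filterS => n.
by rewrite rnormE ltcR.
Qed.

Lemma rnorm_complete (u : nat -> A) :
  (forall e : R, 0 < e ->
     exists n, \forall m \near \oo, rnorm (u n - u m) < e) ->
  exists l : A, u @ \oo --> l.
Proof.
move=> cu; suff : cvg (u @ \oo) by move=> cvu; exists (lim (u @ \oo)).
apply/cauchy_cvgP; apply: cauchy_exP => e e0.
(* The filter characterisation takes [e] in [R[i]], where [0 < e] forces [e] to be real. *)
have eR : (complex.Re e)%:C = e by rewrite RRe_real ?gtr0_real.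
have e0' : 0 < complex.Re e by rewrite -ltcR eR.
have [n un] := cu _ e0'; exists (u n).
move: un; apply: filterS => m um.
by rewrite -ball_normE /ball_/= rnormE (lt_le_trans (y := (complex.Re e)%:C)) ?ltcR ?eR.
Qed.

Lemma neumann x : rnorm x < 1 -> invertible (1 - x).
Proof.
set r := rnorm x => r1; have r0 : 0 <= r := rnorm_ge0 x.
pose u n : A := \sum_(i < n) x ^+ i.
have ul n : (1 - x) * u n = 1 - x ^+ n.
  by rewrite -opprB mulNr -subrX1 opprB.
have ur n : u n * (1 - x) = 1 - x ^+ n.
  have : GRing.comm (u n) (1 - x).
    apply: commr_sym; apply: commr_sum => i _; apply: commr_sym.
    by apply: commrB; [exact: commr1|exact/commr_sym/commrX].
  by move=> ->.
have rb n : rnorm (u n) <= (1 - r)^-1.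
  rewrite (le_trans (rnorm_sum _ _))//.
  rewrite (le_trans (ler_sum _ (fun (i : 'I_n) _ => rnormX_le x i)))//.
  rewrite -[leRHS]mul1r ler_pdivlMr ?subr_gt0//.
  by rewrite mulrC -opprB mulNr -subrX1 opprB gerBl exprn_ge0.
have rn : forall e : R, 0 < e -> \forall n \near \oo, r ^+ n < e.
  move=> e e0; have := @cvg_expr R r.
  rewrite ger0_norm// => /(_ r1)/cvgrPdist_lt/(_ _ e0); apply: filterS => n.
  by rewrite sub0r normrN ger0_norm// exprn_ge0.
have [l cl] : exists l : A, u @ \oo --> l.
  apply: rnorm_complete => e e0.
  have e1 : 0 < e * (1 - r) by rewrite mulr_gt0 ?subr_gt0.
  have [n _ /(_ n (leqnn n))/= hn] := rn _ e1; exists n.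
  exists n => // m /= nm; rewrite -rnormN opprB.
  have -> : u m - u n = x ^+ n * u (m - n)%N.
    rewrite /u -(subnKC nm) big_split_ord /= addrAC subrr add0r addKn mulr_sumr.
    by apply: eq_bigr => i _; rewrite exprD.
  rewrite (le_lt_trans (rnormM _ _))//.
  apply: (le_lt_trans (ler_pM _ _ (rnormX_le x n) (rb (m - n)%N))); rewrite ?rnorm_ge0//.
  by rewrite ltr_pdivrMr ?subr_gt0.
(* For the limit [l], [(1 - x) l - 1 = (1 - x) (l - u n) - x^n], and symmetrically on the other
   side. The error is at most [|1 - x| d + d], whence [d = e / (|1 - x| + 1)]. *)
have small e : 0 < e -> exists n (d : R),
    [/\ rnorm (l - u n) <= d, rnorm (x ^+ n) <= d & rnorm (1 - x) * d + d <= e].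
  move=> e0; set M := rnorm (1 - x).
  have M1 : 0 < M + 1 by rewrite ltr_wpDl ?rnorm_ge0.
  have d0 : 0 < e / (M + 1) by rewrite divr_gt0.
  have [n [h1 h2]] := filter_ex (filterI (cvg_rnorm cl d0) (rn _ d0)).
  exists n, (e / (M + 1)); split; first exact: ltW.
    exact: le_trans (rnormX_le _ _) (ltW h2).
  by rewrite -{2}(mul1r (e / _)) -mulrDl mulrC divfK// gt_eqF.
exists l; split; apply/eqP; rewrite -subr_eq0; apply/eqP/rnorm_eq0_small
  => e /small[n [d [h1 h2]]]; apply: le_trans.
- have -> : (1 - x) * l - 1 = (1 - x) * (l - u n) - x ^+ n.
    by rewrite mulrBr ul opprB addrA [RHS]addrAC addrK.
  rewrite (le_trans (rnormD _ _))// rnormN lerD//.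
  by rewrite (le_trans (rnormM _ _))// ler_wpM2l// rnorm_ge0.
- have -> : l * (1 - x) - 1 = (l - u n) * (1 - x) - x ^+ n.
    by rewrite mulrBl ur opprB addrA [RHS]addrAC addrK.
  rewrite (le_trans (rnormD _ _))// rnormN lerD//.
  by rewrite (le_trans (rnormM _ _))// mulrC ler_wpM2l// rnorm_ge0.
Qed.

Lemma resolvent_gt_norm c x :
  rnorm x < complex.Re `|c| -> invertible (c%:A - x).
Proof.
move=> xc; have c0 : c != 0.
  by apply: contraTneq xc => ->; rewrite normr0 -leNgt rnorm_ge0.
have -> : c%:A - x = c *: (1 - c^-1 *: x).
  by rewrite scalerBr scalerA divff// scale1r.
apply/invertibleZ/neumann => //.
rewrite rnormZ normfV.
have cR : (complex.Re `|c|)%:C = `|c| by rewrite RRe_real.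
have c0' : 0 < complex.Re `|c| by rewrite (le_lt_trans _ xc) ?rnorm_ge0.
by rewrite -cR -fmorphV /= mulrC ltr_pdivrMr ?mul1r.
Qed.

End Invertible.

(** * Spectral radius of self-adjoint elements *)

Section SelfAdjoint.
Variables (R : realType) (A : cstarAlgType R).
Implicit Types (x y h : A) (c z : R[i]) (r s t : R) (p q : {poly R}).

Lemma starZr r x : star (r%:C *: x) = r%:C *: star x.
Proof. by rewrite starZ conjc_real. Qed.

Lemma star_scalar r : star (r%:C%:A : A) = r%:C%:A.
Proof. by rewrite starZr star1. Qed.

Lemma rnorm_scalar r : rnorm (r%:C%:A : A) = `|r|.
Proof. by rewrite rnormZr rnorm1 mulr1. Qed.

(** With the C*-identity this gives [|x + iy|^2 = |x^2 + y^2|] for commuting self-adjoint [x] and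
    [y]. *)
Lemma star_mul_cartesian x y : selfadjoint x -> selfadjoint y ->
  GRing.comm x y -> star (x + 'i%C *: y) * (x + 'i%C *: y) = x * x + y * y.
Proof.
move=> sx sy xy; rewrite starD starZ sx sy.
have -> : conjc 'i%C = - 'i%C :> R[i] by apply/eqP; rewrite eq_complex /= oppr0 !eqxx.
rewrite scaleNr mulrBl !mulrDr -!scalerAl -!scalerAr scalerA -(expr2 'i%C) sqr_i.
by rewrite scaleN1r opprD opprK xy addrA addrK.
Qed.

Lemma rnorm_selfadjoint_sqr x : selfadjoint x -> rnorm (x * x) = rnorm x ^+ 2.
Proof. by move=> sx; rewrite -{1}sx rnorm_star_mul. Qed.

Lemma rnorm_selfadjoint_exp2 x k :
  selfadjoint x -> rnorm (x ^+ (2 ^ k)) = rnorm x ^+ (2 ^ k).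
Proof.
elim: k x => [|k IH] x sx; first by rewrite !expr1.
have sxx : selfadjoint (x * x) by rewrite /selfadjoint star_mul sx.
by rewrite expnS !exprM !expr2 IH// rnorm_selfadjoint_sqr.
Qed.

Lemma spectrum_selfadjoint h z : selfadjoint h -> spectrum h z -> complex.Im z = 0.
Proof.
move=> sh hz; apply: contrapT => /eqP b0; apply: hz.
case: z b0 => a b /= b0.
(* Adding [i n] to both terms leaves the difference unchanged. Then [|h + i n|^2 <= |h|^2 + n^2],
   which is below [a^2 + (b + n)^2] because [2 b n = |h|^2 + 1]. *)
set n : R := (rnorm h ^+ 2 + 1) / (2 * b).
have -> : (a +i* b)%:A - h = (a +i* (b + n))%:A - (h + 'i%C *: n%:C%:A).
  rewrite opprD addrA addrAC scalerA -scalerBl; congr (_ *: _ - _).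
  by apply/eqP; rewrite eq_complex /=; apply/andP; split; apply/eqP; ring.
have bn : rnorm h ^+ 2 + n ^+ 2 < a ^+ 2 + (b + n) ^+ 2.
  have -> : (b + n) ^+ 2 = b ^+ 2 + (rnorm h ^+ 2 + 1) + n ^+ 2.
    by rewrite /n; field.
  by have := sqr_ge0 a; have := sqr_ge0 b; nra.
apply: resolvent_gt_norm; rewrite normc_def /=.
rewrite -(ltr_pXn2r (n := 2)) ?nnegrE ?rnorm_ge0 ?sqrtr_ge0//.
rewrite sqr_sqrtr ?addr_ge0 ?sqr_ge0//.
apply: le_lt_trans bn; rewrite -(rnorm_star_mul (h + _)) star_mul_cartesian//; last 2 first.
- exact: star_scalar.
- by rewrite /GRing.comm -scalerAl -scalerAr mul1r mulr1.
rewrite (le_trans (rnormD _ _))// lerD//.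
  by rewrite rnorm_selfadjoint_sqr.
by rewrite rnorm_selfadjoint_sqr ?rnorm_scalar ?real_normK ?num_real//; exact: star_scalar.
Qed.

(* Real polynomials in [h]: they are self-adjoint and commute, and identities    *)
(* between them can be proved by [ring] in [{poly R}].                          *)
Definition peval h : {rmorphism {poly R} -> A} :=
  horner_alg h \o map_poly (real_complex R).

Lemma pevalC h r : peval h r%:P = r%:C%:A.
Proof. by rewrite /= map_polyC /= /horner_alg horner_morphC. Qed.

Lemma pevalX h : peval h 'X = h.
Proof. by rewrite /= map_polyX /horner_alg horner_morphX. Qed.

Lemma peval_selfadjoint h p : selfadjoint h -> selfadjoint (peval h p).
Proof.
move=> sh; elim/poly_ind: p => [|p r IH]; first by rewrite rmorph0 /selfadjoint star0.
rewrite rmorphD rmorphM pevalX pevalC /selfadjoint starD star_mul sh IH star_scalar.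
congr (_ + _); rewrite -{1 4}(pevalX h) -!rmorphM.
by rewrite mulrC.
Qed.

(** With [w = x + iy], [2i y = w - star w], and [star] is isometric. *)
Lemma rnorm_im_le x y : selfadjoint x -> selfadjoint y ->
  rnorm y <= rnorm (x + 'i%C *: y).
Proof.
move=> sx sy; set w := x + _.
have wE : (2 * 'i%C) *: y = w - star w.
  rewrite /w starD starZ sx sy.
  have -> : conjc 'i%C = - 'i%C :> R[i] by apply/eqP; rewrite eq_complex /= oppr0 !eqxx.
  by rewrite scaleNr opprD opprK addrACA subrr add0r -scalerDl -mulr2n mulr_natl.
have : rnorm ((2 * 'i%C) *: y) <= rnorm w *+ 2.
  by rewrite wE (le_trans (rnormD _ _))// rnormN rnorm_star mulr2n.
have -> : rnorm ((2 * 'i%C) *: y) = 2 * rnorm y.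
  rewrite rnormZ normrM normr_nat.
  have -> : `|'i%C : R[i]| = 1 by rewrite normc_def /= expr0n expr1n add0r sqrtr1.
  by rewrite mulr1.
by rewrite mulr_natl ler_pMn2r.
Qed.

(* With [x = p (1 - q^2)] and [y = 2 p q], [x + iy = p (1 + iq)^2] has norm      *)
(* [|p (1 + q^2)|] because [x^2 + y^2 = (p (1 + q^2))^2].                       *)
Lemma peval_mul_le h p q : selfadjoint h ->
  2 * rnorm (peval h (p * q)) <= rnorm (peval h (p * (1 + q ^+ 2))).
Proof.
move=> sh; set X := p * (1 - q ^+ 2); set Y := 2%:P * (p * q).
have -> : 2 * rnorm (peval h (p * q)) = rnorm (peval h Y).
  rewrite /Y (rmorphM _ 2%:P) pevalC -scalerAl mul1r rnormZr.
  by rewrite ger0_norm.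
have sX := peval_selfadjoint X sh; have sY := peval_selfadjoint Y sh.
apply: le_trans (rnorm_im_le sX sY) _.
rewrite -(ler_pXn2r (n := 2)) ?nnegrE ?rnorm_ge0// -rnorm_star_mul.
rewrite star_mul_cartesian//; last by rewrite /GRing.comm -!rmorphM mulrC.
rewrite -rnorm_selfadjoint_sqr; last exact: peval_selfadjoint.
rewrite -!rmorphM -rmorphD le_eqVlt; apply/orP; left; apply/eqP.
congr (rnorm (peval h _)); rewrite /X /Y polyCMn.
by ring.
Qed.

(** Each step gains a factor 2 from [peval_mul_le] and replaces [q] by [q^2]: with [m = 2^k - 1],
    the exponent [2^(k+1) - 1] is [2m + 1]; one factor [q] is split off, and
    [(1 - q^2) (1 + q^2) = 1 - q^4]. *)
Lemma peval_geometric h q k : selfadjoint h ->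
  2 ^+ k * rnorm (peval h ((1 - q ^+ 2) * q ^+ (2 ^ k).-1))
  <= rnorm (peval h (1 - q ^+ (2 ^ k.+1))).
Proof.
move=> sh; elim: k q => [|k IH] q.
  by rewrite expn0 expn1 /= !expr0 mul1r mulr1.
apply: le_trans (_ : _ <= 2 ^+ k * rnorm (peval h
  ((1 - (q ^+ 2) ^+ 2) * (q ^+ 2) ^+ (2 ^ k).-1))) _; last first.
  by apply: le_trans (IH (q ^+ 2)) _; rewrite -exprM -expnS.
rewrite exprS -mulrA mulrCA ler_pM2l ?exprn_gt0//.
have -> : (2 ^ k.+1).-1 = ((2 ^ k).-1 * 2).+1.
  by have := expn_gt0 2 k; rewrite expnS; case: (2 ^ k)%N => // m _; rewrite mul2n muln2.
set m := (2 ^ k).-1.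
have -> : (1 - q ^+ 2) * q ^+ (m * 2).+1 = (1 - q ^+ 2) * q ^+ (m * 2) * q.
  by rewrite (exprSr q (m * 2)) mulrA.
apply: le_trans (peval_mul_le _ _ sh) _.
rewrite le_eqVlt; apply/orP; left; apply/eqP; congr (rnorm (peval h _)).
by rewrite mulnC exprM; ring.
Qed.

Lemma norm_in_spectrum h : selfadjoint h -> rnorm h = 1 ->
  ~ (invertible (1 - h) /\ invertible (1 + h)).
Proof.
move=> sh h1 [im ip]; have [y [_ yh]] := invertibleM im ip.
(* [y] inverts [1 - h^2], so [h^(2^k) = y (1 - h^2) h^(2^k - 1) h]; the left side has norm 1 and the
   right side norm at most [2 |y| / 2^k]. *)
have bound k : 2 ^+ k <= 2 * rnorm y.
  have -> : 2 ^+ k = 2 ^+ k * rnorm (h ^+ (2 ^ k)) :> R.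
    by rewrite rnorm_selfadjoint_exp2// h1 expr1n mulr1.
  have -> : h ^+ (2 ^ k) = y * (peval h ((1 - 'X ^+ 2) * 'X ^+ (2 ^ k).-1) * h).
    rewrite rmorphM rmorphB rmorph1 !rmorphXn pevalX -mulrA -exprSr prednK ?expn_gt0//.
    have -> : 1 - h ^+ 2 = (1 - h) * (1 + h).
      by rewrite mulrDr mulr1 mulrBl mul1r addrA subrK -expr2.
    by rewrite mulrA yh mul1r.
  apply: le_trans (_ : _ <= 2 ^+ k * (rnorm y *
      (rnorm (peval h ((1 - 'X ^+ 2) * 'X ^+ (2 ^ k).-1)) * 1))) _.
    rewrite ler_pM2l ?exprn_gt0// (le_trans (rnormM _ _))//.
    by rewrite ler_wpM2l ?rnorm_ge0// -h1 rnormM.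
  rewrite mulr1 mulrCA mulrC ler_wpM2r ?rnorm_ge0//.
  apply: le_trans (peval_geometric 'X k sh) _.
  rewrite rmorphB rmorph1 rmorphXn pevalX (le_trans (rnormD _ _))// rnormN rnorm1.
  by rewrite rnorm_selfadjoint_exp2// h1 expr1n.
have := bound (Num.truncn (2 * rnorm y)).+1; apply/negP; rewrite -ltNge.
apply: lt_le_trans (truncnS_gt _) _.
by rewrite -natrX ler_nat ltnW// ltn_expl.
Qed.

(** If [r < |h|], the hypothesis at [t = |h|] and [t = - |h|] contradicts [norm_in_spectrum] for
    [h / |h|]. *)
Lemma rnorm_le_spectrum h r : selfadjoint h -> 0 <= r ->
  (forall t, r < `|t| -> invertible (t%:C%:A - h)) -> rnorm h <= r.
Proof.
move=> sh r0 hr; rewrite leNgt; apply/negP => rh.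
have h0 : 0 < rnorm h := le_lt_trans r0 rh.
have h0' : rnorm h != 0 by rewrite gt_eqF.
have hC : (rnorm h)^-1%:C != 0 :> R[i].
  by apply/eqP => -[] /eqP; rewrite invr_eq0 (negbTE h0').
pose g : A := (rnorm h)^-1%:C *: h.
have sg : selfadjoint g by rewrite /selfadjoint starZr sh.
have hV : (rnorm h)^-1%:C * (rnorm h)%:C = 1 :> R[i].
  by rewrite -rmorphM /= mulVf.
apply: (@norm_in_spectrum g) => //.
  by rewrite rnormZr ger0_norm ?invr_ge0 ?rnorm_ge0// mulVf.
split.
- have -> : 1 - g = (rnorm h)^-1%:C *: ((rnorm h)%:C%:A - h).
    by rewrite scalerBr scalerA hV scale1r.
  by apply: invertibleZ => //; apply: hr; rewrite ger0_norm// ltW.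
- have -> : 1 + g = (rnorm h)^-1%:C *: - ((- rnorm h)%:C%:A - h).
    by rewrite rmorphN scaleNr opprD !opprK scalerDr scalerA hV scale1r.
  apply: invertibleZ => //; apply: invertibleN; apply: hr.
  by rewrite normrN ger0_norm// ltW.
Qed.

End SelfAdjoint.

(** * The positive cone *)

Section Positive.
Variables (R : realType) (A : cstarAlgType R).
Implicit Types (x y h : A) (r s t : R).

Lemma selfadjointD x y : selfadjoint x -> selfadjoint y -> selfadjoint (x + y).
Proof. by rewrite /selfadjoint starD => -> ->. Qed.

Lemma selfadjointN x : selfadjoint x -> selfadjoint (- x).
Proof. by rewrite /selfadjoint starN => ->. Qed.

Lemma selfadjoint_scalar r : selfadjoint (r%:C%:A : A).
Proof. exact: star_scalar. Qed.

Lemma invertible_reflect r t x :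
  invertible (r%:C%:A - (t%:C%:A - x)) -> invertible ((t - r)%:C%:A - x).
Proof.
move=> /invertibleN; rewrite rmorphB /= scalerBl opprB.
by congr invertible; rewrite addrAC.
Qed.

(** The spectrum is real, and for [s < 0] the number [t - s] exceeds [|t - x|], so it is not in the
    spectrum of [t - x]; reflecting, [s] is not in that of [x]. *)
Lemma positive_of_norm x t :
  selfadjoint x -> rnorm (t%:C%:A - x) <= t -> positive x.
Proof.
move=> sx xt; split=> // z zx; have := spectrum_selfadjoint sx zx.
case: z zx => s b /= zx b0; rewrite {b}b0 in zx *.
rewrite lecE /= eqxx /= leNgt; apply/negP => s0; apply: zx.
have t0 : 0 <= t := le_trans (rnorm_ge0 _) xt.
rewrite -[s](subKr t); apply: invertible_reflect; apply: resolvent_gt_norm.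
apply: le_lt_trans xt _; rewrite normc_def /= expr0n addr0 sqrtr_sqr.
by rewrite ger0_norm; lra.
Qed.

Lemma positive_invertible x s : positive x -> s < 0 -> invertible (s%:C%:A - x).
Proof.
move=> [_ xp] s0; apply: contrapT => /(xp s%:C).
by rewrite lecE /= eqxx /= leNgt s0.
Qed.

Lemma norm_of_positive x t :
  positive x -> rnorm x <= t -> rnorm (t%:C%:A - x) <= t.
Proof.
move=> xp xt; have t0 : 0 <= t := le_trans (rnorm_ge0 _) xt.
apply: rnorm_le_spectrum => //.
  by apply/selfadjointD/selfadjointN; [exact: selfadjoint_scalar|case: xp].
move=> u tu; rewrite -[u](subKr t); apply: invertible_reflect; rewrite subKr.
(* If [u > t], then [t - u] is negative and positivity of [x] applies; if [u < - t], then [t - u]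
   exceeds [|x|]. *)
have [ut|ut] := ltP t u; first by apply: positive_invertible; rewrite ?subr_lt0.
apply: resolvent_gt_norm; apply: le_lt_trans xt _.
rewrite normc_def /= expr0n addr0 sqrtr_sqr.
have u0 : u < 0.
  by rewrite ltNge; apply/negP => u0; move: tu; rewrite ger0_norm// ltNge ut.
by move: tu; rewrite ltr0_norm// ger0_norm; lra.
Qed.

Lemma positiveD x y : positive x -> positive y -> positive (x + y).
Proof.
move=> xp yp; apply: (@positive_of_norm _ (rnorm x + rnorm y)).
  by apply: selfadjointD; [case: xp|case: yp].
rewrite rmorphD /= scalerDl opprD addrACA (le_trans (rnormD _ _))//.
by rewrite lerD// norm_of_positive.
Qed.

Lemma positiveZ r x : 0 <= r -> positive x -> positive (r%:C *: x).
Proof.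
move=> r0 xp; apply: (@positive_of_norm _ (r * rnorm x)).
  by rewrite /selfadjoint starZr; case: xp => ->.
rewrite rmorphM /= -scalerA -scalerBr rnormZr ger0_norm// ler_wpM2l//.
exact: norm_of_positive.
Qed.

Lemma positive_scalar r : 0 <= r -> positive (r%:C%:A : A).
Proof.
move=> r0; apply: (@positive_of_norm _ r); first exact: selfadjoint_scalar.
by rewrite subrr rnorm0.
Qed.

Lemma positive_rnorm_sub h : selfadjoint h -> positive ((rnorm h)%:C%:A - h).
Proof.
move=> sh; apply: (@positive_of_norm _ (rnorm h)).
  by apply/selfadjointD/selfadjointN => //; exact: selfadjoint_scalar.
by rewrite subKr.
Qed.

Lemma positive_sum (I : Type) (s : seq I) (F : I -> A) :
  (forall i, positive (F i)) -> positive (\sum_(i <- s) F i).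
Proof.
move=> Fp; elim/big_ind : _ => //; last exact: positiveD.
by rewrite -(scale0r 1); exact: positive_scalar.
Qed.

Lemma positive_scalar_ge0 r : positive (r%:C%:A : A) -> 0 <= r.
Proof.
move=> rp; rewrite leNgt; apply/negP => r0.
have [y []] := positive_invertible rp r0.
by rewrite subrr mul0r => /esym/eqP; rewrite oner_eq0.
Qed.

(** A real [t > r] is excluded from the spectrum of [h] by positivity of [r - h], and [t < - r] by
    positivity of [r + h]. *)
Lemma rnorm_le_of_positive h r :
  selfadjoint h -> positive (r%:C%:A - h) -> positive (r%:C%:A + h) ->
  rnorm h <= r.
Proof.
move=> sh p1 p2.
have r0 : 0 <= r.
  have /positive_scalar_ge0 : positive ((r + r)%:C%:A : A).
    have -> : (r + r)%:C%:A = (r%:C%:A - h) + (r%:C%:A + h).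
      by rewrite rmorphD /= scalerDl addrACA addNr addr0.
    exact: positiveD.
  by rewrite -mulr2n pmulrn_lge0.
apply: rnorm_le_spectrum => // t; have [t0|t0] := leP 0 t => rt.
  rewrite ger0_norm// in rt.
  rewrite -[t](subKr r); apply: invertible_reflect.
  by apply: positive_invertible; rewrite ?subr_lt0.
rewrite ltr0_norm// in rt.
have := @positive_invertible _ (r + t) p2; rewrite rmorphD /= scalerDl.
by rewrite opprD addrACA subrr add0r; apply; lra.
Qed.

End Positive.

(** * Sublinear functionals *)

Section Infimum.
Variable R : realType.
Implicit Types (S X Y : set R).

Lemma inf_le_add S X Y : has_lbound S -> X !=set0 -> Y !=set0 ->
  (forall x y, X x -> Y y -> exists2 s, S s & s <= x + y) ->
  inf S <= inf X + inf Y.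
Proof.
move=> lS X0 Y0 h; rewrite -lerBlDr; apply: lb_le_inf => // x Xx.
rewrite lerBlDr -lerBlDl; apply: lb_le_inf => // y Yy.
by rewrite lerBlDl; have [s Ss sxy] := h x y Xx Yy; rewrite (le_trans _ sxy)// ge_inf.
Qed.

Lemma inf_le_mul S X r : has_lbound S -> X !=set0 -> 0 < r ->
  (forall x, X x -> exists2 s, S s & s <= r * x) -> inf S <= r * inf X.
Proof.
move=> lS X0 r0 h; rewrite -ler_pdivrMl//; apply: lb_le_inf => // x Xx.
rewrite ler_pdivrMl//.
by have [s Ss sx] := h x Xx; rewrite (le_trans _ sx)// ge_inf.
Qed.

End Infimum.

Section Sublinear.
Variables (R : realType) (V : lmodType R[i]).
Implicit Types (x y : V) (r t : R) (p q : V -> R).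

Definition sublinear q :=
  (forall x y, q (x + y) <= q x + q y) /\
  (forall r x, 0 <= r -> q (r%:C *: x) = r * q x).

Lemma sublinearP q : (forall x y, q (x + y) <= q x + q y) -> q 0 = 0 ->
  (forall r x, 0 < r -> q (r%:C *: x) <= r * q x) -> sublinear q.
Proof.
move=> qD q0 qZ; split=> // r x; rewrite le_eqVlt => /orP[/eqP<-|r0].
  by rewrite scale0r q0 mul0r.
apply/le_anti; rewrite qZ//= -ler_pdivlMl//.
have := qZ r^-1 (r%:C *: x); rewrite invr_gt0 => /(_ r0).
by rewrite scalerA -rmorphM /= mulVf ?gt_eqF// scale1r.
Qed.

Lemma sublinear0 q : sublinear q -> q 0 = 0.
Proof. by move=> [_ qZ]; have := qZ 0 0 (lexx 0); rewrite scale0r mul0r. Qed.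

Lemma sublinear_ge_oppr q x : sublinear q -> - q (- x) <= q x.
Proof.
move=> ql; have [qD _] := ql.
by rewrite -subr_ge0 opprK -(sublinear0 ql) -(subrr x) qD.
Qed.

(** For sublinear [q], this is the largest sublinear functional below [q] whose value at [- y] is at
    most [- q y]. *)
Definition linearize q y x : R :=
  inf [set q (x + t%:C *: y) - t * q y | t in [set t | 0 <= t]].

Section Linearize.
Variables (q : V -> R) (ql : sublinear q) (y : V).

Let lb x : has_lbound [set q (x + t%:C *: y) - t * q y | t in [set t | 0 <= t]].
Proof.
have [qD qZ] := ql; exists (- q (- x)) => _ [t /= t0 <-].
rewrite lerBrDr addrC lerBlDr -qZ//.
by rewrite -{1}(addKr x (t%:C *: y)) addrC qD.
Qed.

Let nonempty x : [set q (x + t%:C *: y) - t * q y | t in [set t | 0 <= t]] !=set0.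
Proof. by eexists; exists 0 => /=. Qed.

Lemma linearize_le_shift x t : 0 <= t ->
  linearize q y x <= q (x + t%:C *: y) - t * q y.
Proof. by move=> t0; apply: ge_inf => //; exists t. Qed.

Lemma linearize_le x : linearize q y x <= q x.
Proof.
by apply: le_trans (linearize_le_shift x (lexx 0)) _; rewrite scale0r addr0 mul0r subr0.
Qed.

Lemma linearize_opp : linearize q y (- y) <= - q y.
Proof.
apply: le_trans (linearize_le_shift _ ler01) _.
by rewrite scale1r addNr (sublinear0 ql) mul1r sub0r.
Qed.

Lemma linearize_sublinear : sublinear (linearize q y).
Proof.
have [qD qZ] := ql; apply: sublinearP.
- move=> x1 x2; apply: inf_le_add => // _ _ [t1 /= t10 <-] [t2 /= t20 <-].
  eexists; first by exists (t1 + t2) => //=; rewrite addr_ge0.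
  rewrite addrACA -opprD -mulrDl lerB// rmorphD /= scalerDl addrACA.
  exact: qD.
- apply/le_anti; rewrite -{1}(sublinear0 ql) linearize_le /=.
  by apply: lb_le_inf => // _ [t /= t0 <-]; rewrite add0r qZ// subrr.
- move=> r x r0; apply: inf_le_mul => // _ [t /= t0 <-].
  eexists; first by exists (r * t) => //=; rewrite mulr_ge0// ltW.
  by rewrite rmorphM /= -scalerA -scalerDr qZ ?(ltW r0)// -mulrA -mulrBr.
Qed.

End Linearize.

Lemma minimal_sublinear p : sublinear p ->
  exists q, [/\ sublinear q, (forall x, q x <= p x) &
    forall q', sublinear q' -> (forall x, q' x <= q x) -> q' = q].
Proof.
move=> pl; pose T := {q | sublinear q /\ forall x, q x <= p x}.
(* The order is reversed, so that a maximal element for Zorn's lemma is a minimal functional. *)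
pose below (s t : T) : bool := `[< forall x, sval t x <= sval s x >].
have [||||[q [ql qp]] qmin] := @Zorn T below.
- by move=> t; apply/asboolP.
- move=> r s t /asboolP rs /asboolP st; apply/asboolP => x.
  exact: le_trans (st x) (rs x).
- move=> [s hs] [t ht] /asboolP /= st /asboolP /= ts; apply: eq_exist => /=.
  by apply/funext => x; apply/le_anti; rewrite st ts.
- move=> C Ctot; have [[c Cc]|C0] := pselect (C !=set0); last first.
    have pp : sublinear p /\ forall x, p x <= p x by split.
    by exists (exist _ p pp) => s Cs; exfalso; apply: C0; exists s.
  pose m x : R := inf [set sval s x | s in C].
  have lb x : has_lbound [set sval s x | s in C].
    exists (- p (- x)) => _ [[s [sl sp]] _ <-] /=.
    by rewrite (le_trans _ (sublinear_ge_oppr x sl))// lerN2.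
  have ne x : [set sval s x | s in C] !=set0 by exists (sval c x); exists c.
  have mle s x : C s -> m x <= sval s x by move=> Cs; apply: ge_inf => //; exists s.
  have ml : sublinear m.
    apply: sublinearP.
    (* Of two members of the chain, the smaller one, evaluated at [x + y], is below the sum of their
       values at [x] and [y]. *)
    + move=> x y; apply: inf_le_add => // _ _ [s Cs <-] [t Ct <-].
      case: (Ctot s t Cs Ct) => /asboolP le.
        exists (sval t (x + y)); first by exists t.
        by case: (svalP t) => -[tD _] _; rewrite (le_trans (tD _ _))// lerD.
      exists (sval s (x + y)); first by exists s.
      by case: (svalP s) => -[sD _] _; rewrite (le_trans (sD _ _))// lerD.
    + apply/le_anti/andP; split.
        by rewrite (le_trans (mle c _ Cc))// sublinear0//; case: (svalP c).
      apply: lb_le_inf => // _ [s _ <-].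
      by rewrite sublinear0//; case: (svalP s).
    + move=> r x r0; apply: inf_le_mul => // _ [s Cs <-].
      exists (sval s (r%:C *: x)); first by exists s.
      by case: (svalP s) => -[_ sZ] _; rewrite sZ// ltW.
  have mp x : m x <= p x.
    by apply: le_trans (mle c x Cc) _; case: (svalP c).
  by exists (exist _ m (conj ml mp)) => s Cs; apply/asboolP => x; exact: mle.
- exists q; split=> // q' ql' qq'.
  have qp' : forall x, q' x <= p x by move=> x; exact: le_trans (qp x).
  by have := qmin (exist _ q' (conj ql' qp')) (asboolT qq') => -[].
Qed.

(* A minimal sublinear [f] equals [linearize f x], which makes it odd, hence    *)
(* additive; starting from [linearize p a] instead of [p] gives [p a <= f a].   *)
Lemma hahn_banach p a : sublinear p -> exists f : V -> R,
  [/\ {morph f : x y / x + y}, (forall r x, f (r%:C *: x) = r * f x),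
      (forall x, f x <= p x) & f a = p a].
Proof.
move=> pl; have [f [fl fp fmin]] := minimal_sublinear (linearize_sublinear pl a).
have fN x : f (- x) = - f x.
  apply/le_anti; rewrite lerNl sublinear_ge_oppr// andbT.
  rewrite -{1}(fmin _ (linearize_sublinear fl x) (linearize_le fl x)).
  exact: linearize_opp.
have [fD fZ] := fl; exists f; split.
- move=> x y; apply/le_anti; rewrite fD /= -lerBrDr -fN.
  by rewrite (le_trans _ (fD _ _))// addrK.
- move=> r x; have [r0|r0] := leP 0 r; first exact: fZ.
  rewrite -[r]opprK rmorphN scaleNr fN fZ; last by rewrite oppr_ge0 ltW.
  by rewrite !mulNr.
- by move=> x; apply: le_trans (fp x) _; exact: linearize_le.
- apply/le_anti; rewrite (le_trans (fp a)) ?linearize_le//=.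
  by rewrite -lerN2 -fN (le_trans (fp _))// linearize_opp.
Qed.

End Sublinear.

(** * Ergodic sums and invariant states *)

Section Dynamics.
Variables (R : realType) (A : cstarAlgType R).
Implicit Types (x y : A) (r c d e : R) (j : int) (k n : nat).

Section Automorphism.
Variables (f : A -> A) (fP : star_automorphism f).

Lemma automorphismD x y : f (x + y) = f x + f y.
Proof. by case: fP => fl _ _ _; have := fl 1 x y; rewrite !scale1r. Qed.

Lemma automorphism0 : f 0 = 0.
Proof. by apply: (addrI (f 0)); rewrite -automorphismD !addr0. Qed.

Lemma automorphismZ (z : R[i]) x : f (z *: x) = z *: f x.
Proof. by case: fP => fl _ _ _; have := fl z x 0; rewrite automorphism0 !addr0. Qed.

Lemma automorphismB x y : f (x - y) = f x - f y.
Proof. by rewrite automorphismD -scaleN1r automorphismZ scaleN1r. Qed.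

Lemma automorphism1 : f 1 = 1.
Proof.
case: fP => _ fM _ [g fg gf].
by rewrite -[LHS]mulr1 -{2}(gf 1) -fM mul1r gf.
Qed.

Lemma automorphism_selfadjoint x : selfadjoint x -> selfadjoint (f x).
Proof. by case: fP => _ _ fs _ sx; rewrite /selfadjoint -fs sx. Qed.

Lemma automorphism_positive x : positive x -> positive (f x).
Proof.
move=> [sx xp]; split; first exact: automorphism_selfadjoint.
move=> z zfx; apply: xp => -[y [xy yx]]; apply: zfx; exists (f y).
case: fP => _ fM _ _.
have -> : z%:A - f x = f (z%:A - x).
  by rewrite automorphismB automorphismZ automorphism1.
by rewrite -!fM xy yx automorphism1.
Qed.

End Automorphism.

(** Composing with the self-adjoint part extends a functional on self-adjoint elements to all of
    [A], where Hahn-Banach is applied. *)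
Definition repart x : A := 2^-1%:C *: (x + star x).

Lemma repart_selfadjoint x : selfadjoint (repart x).
Proof. by rewrite /selfadjoint /repart starZr starD starK addrC. Qed.

Lemma repartD x y : repart (x + y) = repart x + repart y.
Proof. by rewrite /repart starD addrACA scalerDr. Qed.

Lemma repartZ r x : repart (r%:C *: x) = r%:C *: repart x.
Proof. by rewrite /repart starZr -scalerDr !scalerA mulrC. Qed.

Lemma repartN x : repart (- x) = - repart x.
Proof. by rewrite -scaleN1r -(rmorphN1 (real_complex R)) repartZ rmorphN1 scaleN1r. Qed.

Lemma repart_id x : selfadjoint x -> repart x = x.
Proof.
move=> sx; rewrite /repart sx -mulr2n -(scaler_nat 2 x) scalerA.
by rewrite -(rmorph_nat (real_complex R)) -rmorphM /= mulVf// scale1r.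
Qed.

Lemma repart_skew x : star x = - x -> repart x = 0.
Proof. by rewrite /repart => ->; rewrite subrr scaler0. Qed.

Variables (Theta : int -> A -> A) (hTheta : cstar_dynamical_system Theta).

Let ThetaP j : star_automorphism (Theta j).
Proof. by case: hTheta. Qed.

Lemma Theta0 x : Theta 0 x = x.
Proof.
case: hTheta => auto add; have [_ _ _ [g gK _]] := auto 0.
by apply: (can_inj gK); exact/esym/(congr1 (@^~ x) (add 0 0)).
Qed.

Lemma ThetaS n x : Theta n.+1 x = Theta 1 (Theta n x).
Proof. by case: hTheta => _ add; rewrite -addn1 addnC PoszD add. Qed.

Definition ergodic_sum k x : A := \sum_(j < k) Theta (Posz j) x.

Lemma ergodic_sumD k x y : ergodic_sum k (x + y) = ergodic_sum k x + ergodic_sum k y.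
Proof. by rewrite -big_split; apply: eq_bigr => j _; exact: automorphismD. Qed.

Lemma ergodic_sumZ k (z : R[i]) x : ergodic_sum k (z *: x) = z *: ergodic_sum k x.
Proof. by rewrite scaler_sumr; apply: eq_bigr => j _; exact: automorphismZ. Qed.

Lemma ergodic_sumN k x : ergodic_sum k (- x) = - ergodic_sum k x.
Proof. by rewrite -scaleN1r ergodic_sumZ scaleN1r. Qed.

Lemma ergodic_sum_scalar k r : ergodic_sum k r%:C%:A = (r * k%:R)%:C%:A.
Proof.
rewrite ergodic_sumZ /ergodic_sum (eq_bigr (fun=> 1)); last first.
  by move=> j _; exact: automorphism1.
by rewrite sumr_const card_ord -scaler_nat scalerA rmorphM rmorph_nat.
Qed.

Lemma ergodic_sum_positive k x : positive x -> positive (ergodic_sum k x).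
Proof. by move=> xp; apply: positive_sum => j; exact: automorphism_positive. Qed.

Lemma ergodic_sum_selfadjoint k x : selfadjoint x -> selfadjoint (ergodic_sum k x).
Proof.
move=> sx; rewrite /ergodic_sum; elim/big_ind : _ => [|? ?|j _]; first exact: star0.
  exact: selfadjointD.
exact: automorphism_selfadjoint.
Qed.

Lemma ergodic_sum_coboundary k x :
  ergodic_sum k (Theta 1 x - x) = Theta k x - x.
Proof.
elim: k => [|k IH]; first by rewrite /ergodic_sum big_ord0 Theta0 subrr.
rewrite /ergodic_sum big_ord_recr /= -/(ergodic_sum k _) IH automorphismB//.
have -> : Theta k (Theta 1 x) = Theta k.+1 x.
  by case: hTheta => _ add; rewrite -addn1 PoszD add.
by rewrite addrC subrKA.
Qed.

(** The bound is in the order, not in norm: if [- y] is positive it holds with [c = 0], which makes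
    the Hahn-Banach functional positive. *)
Definition ergodic_bound c y : Prop :=
  \forall k \near \oo, positive ((c * k%:R)%:C%:A - ergodic_sum k y).

Lemma ergodic_bound_sup c y : positive (c%:C%:A - y) -> ergodic_bound c y.
Proof.
move=> cy; apply: nearW => k; rewrite -ergodic_sum_scalar -ergodic_sumN -ergodic_sumD.
exact: ergodic_sum_positive.
Qed.

Lemma ergodic_boundD c d x y :
  ergodic_bound c x -> ergodic_bound d y -> ergodic_bound (c + d) (x + y).
Proof.
apply: filterS2 => k px py; rewrite mulrDl rmorphD /= scalerDl ergodic_sumD.
by rewrite opprD addrACA; exact: positiveD.
Qed.

Lemma ergodic_boundZ r c x : 0 <= r ->
  ergodic_bound c x -> ergodic_bound (r * c) (r%:C *: x).
Proof.
move=> r0; apply: filterS => k px.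
by rewrite ergodic_sumZ -mulrA rmorphM /= -scalerA -scalerBr; exact: positiveZ.
Qed.

Lemma ergodic_bound0_ge0 c : ergodic_bound c 0 -> 0 <= c.
Proof.
(* The index [K.+1] is nonzero, so the factor [k] can be cancelled. *)
move=> [K _ /(_ K.+1 (leqnSn K))] /=.
rewrite -(scale0r 0) ergodic_sumZ scale0r subr0 => /positive_scalar_ge0.
by rewrite pmulr_lge0.
Qed.

(** Add the bound [rnorm x] for [- x]. This keeps the infimum in [ergodic_upper] from being a
    default value. *)
Lemma ergodic_bound_ge x c : selfadjoint x -> ergodic_bound c x -> - rnorm x <= c.
Proof.
move=> sx cx.
have xx : ergodic_bound (rnorm x) (- x).
  apply: ergodic_bound_sup; rewrite -(rnormN x).
  by apply: positive_rnorm_sub; exact: selfadjointN.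
have := ergodic_boundD cx xx; rewrite subrr => /ergodic_bound0_ge0.
by rewrite -lerBlDr sub0r.
Qed.

(** The ergodic sum telescopes to [Theta k x - x], which is at most [2 |x|] for every [k], hence at
    most [e k] for large [k]. *)
Lemma ergodic_bound_coboundary x e : selfadjoint x -> 0 < e ->
  ergodic_bound e (Theta 1 x - x).
Proof.
move=> sx e0.
have : \forall k \near \oo, rnorm x *+ 2 / e <= k%:R by exact: nbhs_infty_ger.
apply: filterS => k; rewrite ler_pdivrMr// mulrC => ek; rewrite ergodic_sum_coboundary.
have -> : (e * k%:R)%:C%:A - (Theta k x - x) =
    (e * k%:R - rnorm x *+ 2)%:C%:A +
    (Theta k ((rnorm x)%:C%:A - x) + ((rnorm (- x))%:C%:A - (- x))).
  rewrite rnormN (automorphismB (ThetaP k)) (automorphismZ (ThetaP k)).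
  rewrite (automorphism1 (ThetaP k)).
  rewrite [in RHS]addrACA -scalerDl -rmorphD /= -mulr2n.
  by rewrite rmorphB /= scalerBl subrKA opprD.
apply: positiveD; first by apply: positive_scalar; rewrite subr_ge0.
apply: positiveD; last by apply/positive_rnorm_sub/selfadjointN.
by apply: automorphism_positive => //; exact: positive_rnorm_sub.
Qed.

Definition ergodic_upper x : R := inf [set c | ergodic_bound c (repart x)].

Lemma ergodic_upper_has_lbound x : has_lbound [set c | ergodic_bound c (repart x)].
Proof.
exists (- rnorm (repart x)) => c; apply: ergodic_bound_ge.
exact: repart_selfadjoint.
Qed.

Lemma ergodic_upper_nonempty x : [set c | ergodic_bound c (repart x)] !=set0.
Proof.
exists (rnorm (repart x)); apply: ergodic_bound_sup.
exact/positive_rnorm_sub/repart_selfadjoint.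
Qed.

Lemma ergodic_upper_le x c : ergodic_bound c (repart x) -> ergodic_upper x <= c.
Proof. by move=> cx; apply: ge_inf => //; exact: ergodic_upper_has_lbound. Qed.

Lemma ergodic_upper_sublinear : sublinear ergodic_upper.
Proof.
have lb := ergodic_upper_has_lbound; have ne := ergodic_upper_nonempty.
apply: sublinearP.
- move=> x y; apply: inf_le_add => // c d cx dy; exists (c + d) => //=.
  by rewrite repartD; exact: ergodic_boundD.
- have r0 : repart 0 = 0 by rewrite repart_skew// star0 oppr0.
  apply/le_anti/andP; split.
    apply: ergodic_upper_le; rewrite r0; apply: ergodic_bound_sup.
    by rewrite subr0; exact: positive_scalar.
  by apply: lb_le_inf => // c /=; rewrite r0; exact: ergodic_bound0_ge0.
- move=> r x r0; apply: inf_le_mul => // c cx; exists (r * c) => //=.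
  by rewrite repartZ; apply: ergodic_boundZ => //; exact: ltW.
Qed.

End Dynamics.

(** * Complex-linear functionals from real-linear ones *)

Section Complexify.
Variables (R : realType) (A : cstarAlgType R) (f : A -> R).
Hypotheses (fD : {morph f : x y / x + y})
  (fZ : forall (r : R) x, f (r%:C *: x) = r * f x).
Implicit Types x : A.

(** The only complex-linear functional with real part [f], namely [f x - i f (i x)]. *)
Definition complexify x : R[i] := f x +i* - f ('i%C *: x).

Lemma complexify_scalar : scalar complexify.
Proof.
case=> a b x y; rewrite /complexify scalerDr !fD.
have iE (u v : R) : u +i* v = u%:C + 'i%C * v%:C.
  by apply/eqP; rewrite eq_complex /=; apply/andP; split; apply/eqP; ring.
have fc (u v : R) z : f ((u +i* v) *: z) = u * f z + v * f ('i%C *: z).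
  by rewrite iE mulrC scalerDl -scalerA fD !fZ.
have -> : 'i%C *: ((a +i* b) *: x) = (- b +i* a) *: x.
  by rewrite scalerA; congr (_ *: _); apply/eqP; rewrite eq_complex /=;
    apply/andP; split; apply/eqP; ring.
rewrite (fc a b) (fc (- b) a); apply/eqP; rewrite eq_complex /=.
by apply/andP; split; apply/eqP; ring.
Qed.

Lemma complexify_selfadjoint x : (forall y, star y = - y -> f y = 0) ->
  selfadjoint x -> complexify x = (f x)%:C.
Proof.
move=> f0 sx; rewrite /complexify (f0 ('i%C *: x)) ?oppr0//.
rewrite starZ sx -scaleNr; congr (_ *: _).
by apply/eqP; rewrite eq_complex /= oppr0 !eqxx.
Qed.

End Complexify.

(** * Invariant states and the gauge *)

Section Gauge.
Variables (R : realType) (A : cstarAlgType R).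
Variables (Theta : int -> A -> A) (hTheta : cstar_dynamical_system Theta).
Implicit Types (x a : A) (phi : A -> R[i]).

Let ThetaP j : star_automorphism (Theta j).
Proof. by case: hTheta. Qed.

Lemma invariant_of_shift (T : Type) (phi : A -> T) :
  (forall x, phi (Theta 1 x) = phi x) -> forall j, phi \o Theta j = phi.
Proof.
move=> inv1; have invn n x : phi (Theta (Posz n) x) = phi x.
  elim: n x => [|n IH] x; first by rewrite (Theta0 hTheta).
  by rewrite (ThetaS hTheta) inv1 IH.
move=> j; apply/funext => x /=; case: j => n; first exact: invn.
(* Forward invariance is applied at the point [Theta (- n.+1) x], which [Theta n.+1] maps back to
   [x]. *)
rewrite NegzE -[LHS](invn n.+1); congr phi; case: (hTheta) => _ add.
have /(congr1 (@^~ x)) := add (Posz n.+1) (- Posz n.+1).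
by rewrite subrr (Theta0 hTheta) => /esym.
Qed.

(** Each property of the functional [f] comes from [f <= ergodic_upper]; equalities follow by using
    the bound at [x] and at [- x]. *)
Lemma exists_invariant_state a : selfadjoint a ->
  exists2 phi, invariant_states Theta phi &
    complex.Re (phi a) = ergodic_upper Theta a.
Proof.
move=> sa.
have [f [fD fZ fp fa]] := hahn_banach a (ergodic_upper_sublinear hTheta).
have f_le x c : ergodic_bound Theta c (repart x) -> f x <= c.
  by move=> xc; apply: le_trans (fp x) _; exact: ergodic_upper_le.
have fN x : f (- x) = - f x.
  by rewrite -scaleN1r -(rmorphN1 (real_complex R)) fZ mulN1r.
have f_eq0 x : f x <= 0 -> f (- x) <= 0 -> f x = 0.
  by rewrite fN oppr_le0 => h1 h2; apply/le_anti/andP.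
have f_sup x c : selfadjoint x -> positive (c%:C%:A - x) -> f x <= c.
  by move=> sx cx; apply: f_le; rewrite repart_id//; exact: ergodic_bound_sup.
have f_skew x : star x = - x -> f x = 0.
  move=> sx; have bd0 : ergodic_bound Theta 0 0.
    by apply: ergodic_bound_sup => //; rewrite subr0; exact: positive_scalar.
  by apply: f_eq0; apply: f_le; rewrite ?repartN repart_skew// oppr0.
have f1 : f 1 = 1.
  have sa1 r : f r%:C%:A <= r.
    apply: f_sup; first exact: selfadjoint_scalar.
    by rewrite subrr -(scale0r 1); exact: positive_scalar.
  apply/le_anti/andP; split; first by have := sa1 1; rewrite scale1r.
  by have := sa1 (-1); rewrite rmorphN1 scaleN1r fN lerN2.
have fpos x : positive x -> 0 <= f x.
  move=> xp; rewrite -oppr_le0 -fN; apply: f_sup.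
    by apply: selfadjointN; case: xp.
  by rewrite opprK scale0r add0r.
(* Coboundaries have ergodic bound [e] for every [e > 0]. Replacing [x] by [- x] then gives
   invariance. *)
have f_cob x : f (Theta 1 x - x) <= 0.
  apply/ler_addgt0Pr => e e0; rewrite add0r; apply: f_le.
  have -> : repart (Theta 1 x - x) = Theta 1 (repart x) - repart x.
    rewrite repartD repartN; congr (_ - _).
    rewrite /repart (automorphismZ (ThetaP 1)) (automorphismD (ThetaP 1)).
    by case: (ThetaP 1) => _ _ -> _.
  apply: ergodic_bound_coboundary => //; exact: repart_selfadjoint.
have f_inv x : f (Theta 1 x) = f x.
  apply/eqP; rewrite -subr_eq0 -fN -fD; apply/eqP/f_eq0 => //.
  have -> : - (Theta 1 x - x) = Theta 1 (- x) - (- x).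
    by rewrite opprD -(scaleN1r x) (automorphismZ (ThetaP 1)) !scaleN1r.
  exact: f_cob.
exists (complexify f); last first.
  by rewrite (complexify_selfadjoint f_skew sa).
split; last first.
  apply: invariant_of_shift => x.
  by rewrite /complexify -(automorphismZ (ThetaP 1)) !f_inv.
split; first exact: complexify_scalar.
- move=> x xp; rewrite complexify_selfadjoint//; last by case: xp.
  by rewrite ler0c fpos.
- by rewrite complexify_selfadjoint ?f1//; exact: star1.
Qed.

Definition ergodic_norm a k : R :=
  k%:R^-1 * complex.Re `| \sum_(j < k) Theta (Posz j) a |.

(** Apply [phi] to the positive element [|S_k a| - S_k a]. *)
Lemma invariant_state_le a phi k : selfadjoint a -> invariant_states Theta phi ->
  (0 < k)%N -> complex.Re (phi a) <= ergodic_norm a k.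
Proof.
move=> sa [[phil phip phi1] inv] k0.
have phiD x y : phi (x + y) = phi x + phi y.
  by have := phil 1 x y; rewrite scale1r mul1r.
have phi0 : phi 0 = 0 by apply: (addrI (phi 0)); rewrite -phiD !addr0.
have phiZ (z : R[i]) x : phi (z *: x) = z * phi x.
  by have := phil z x 0; rewrite !addr0 phi0 addr0.
rewrite /ergodic_norm -/(ergodic_sum Theta k a) -/(rnorm (ergodic_sum Theta k a)).
have phiS : phi (ergodic_sum Theta k a) = k%:R * phi a.
  rewrite (big_morph phi phiD phi0) (eq_bigr (fun=> phi a)); last first.
    by move=> j _; rewrite -[in RHS](inv j).
  by rewrite sumr_const card_ord mulr_natl.
have /positive_rnorm_sub/phip : selfadjoint (ergodic_sum Theta k a).
  exact: ergodic_sum_selfadjoint.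
rewrite phiD -scaleN1r !phiZ phi1 phiS mulr1 mulN1r.
rewrite -(rmorph_nat (real_complex R)) lecE /= => /andP[_].
case: (phi a) => u v /=; rewrite mul0r subr0 subr_ge0 => uk.
by rewrite ler_pdivlMl ?ltr0n.
Qed.

(** Positivity of [a] supplies the missing lower bound: [c k + S_k a = (c k - S_k a) + 2 S_k a] is
    positive. *)
Lemma ergodic_norm_le a c k : positive a ->
  positive ((c * k%:R)%:C%:A - ergodic_sum Theta k a) -> (0 < k)%N ->
  ergodic_norm a k <= c.
Proof.
move=> ap cp k0; rewrite /ergodic_norm ler_pdivrMl ?ltr0n// mulrC.
have Sp := ergodic_sum_positive hTheta k ap.
apply: rnorm_le_of_positive => //; first by case: Sp.
have -> : (c * k%:R)%:C%:A + ergodic_sum Theta k a =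
    ((c * k%:R)%:C%:A - ergodic_sum Theta k a) +
    (ergodic_sum Theta k a + ergodic_sum Theta k a) by rewrite addrA subrK.
by apply: positiveD => //; exact: positiveD.
Qed.

Lemma ergodic_norm_cvg a : positive a ->
  ergodic_norm a @ \oo --> max_value a (invariant_states Theta).
Proof.
move=> ap; have sa : selfadjoint a by case: ap.
set m := max_value _ _.
have [phi phiI phia] := exists_invariant_state sa.
have m_le k : (0 < k)%N -> m <= ergodic_norm a k.
  (* The state [phi] shows that the set of values is nonempty; below, the average at [k = 1] bounds
     it above. Thus [m] is a genuine supremum. *)
  move=> k0; apply: sup_le_ub; first by exists (complex.Re (phi a)); exists phi.
  by move=> _ [psi psiI <-]; exact: invariant_state_le.
have upper_le : ergodic_upper Theta a <= m.
  rewrite -phia; apply: sup_ubound; last by exists phi.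
  exists (ergodic_norm a 1) => _ [psi psiI <-]; exact: invariant_state_le.
apply/cvgrPdist_le => e e0.
have [c /= ca cm] : exists2 c, ergodic_bound Theta c (repart a) & c < m + e.
  apply: (@inf_lt _ [set c | ergodic_bound Theta c (repart a)]).
    exact: ergodic_upper_nonempty.
  by apply: le_lt_trans upper_le _; rewrite ltrDl.
rewrite repart_id// in ca.
move: ca; apply: filterS2 (nbhs_infty_gt 0) => k k0 ck.
rewrite distrC ger0_norm ?subr_ge0 ?m_le// lerBlDl.
exact: le_trans (ergodic_norm_le ap ck k0) (ltW cm).
Qed.

End Gauge.

Theorem theorem2p4 (R : realType) (A : cstarAlgType R) (Theta : int -> A -> A)
    (hTheta : cstar_dynamical_system Theta) (hsep : separable A)
    (a : A) (ha : positive a) :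
  gauge Theta a = max_value a (invariant_states Theta).
Proof. exact: cvg_lim (ergodic_norm_cvg hTheta ha). Qed.
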